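(* Let $\Gamma$ be a finite extensive game. Every game with awareness of unawareness $\Gamma^*=(\mathcal{G},\Gamma^m,\mathcal{F})$ based on $\Gamma$ has a generalized Nash equilibrium.
   Context: Extensive games. A finite extensive game is $\Gamma=(N,M,H,P,f_c,\{\mathcal{I}_i\}_{i\in N},\{u_i\}_{i\in N})$: $N$ finite set of players; $M$ finite set of moves; $H$ finite prefix-closed set of finite move sequences (histories); $Z$ the runs (histories not strict prefixes of others); $M_h=\{m:h\cdot\langle m\rangle\in H\}$; $P:H\setminus Z\to N\cup\{c\}$ ($c$ = nature); $H_i=P^{-1}(i)$; $f_c(\cdot\mid h)$ a probability measure on $M_h$ when $P(h)=c$; $\mathcal{I}_i$ a partition of $H_i$ into information sets with $M_h=M_{h'}$ within a cell; $u_i:Z\to\mathbb{R}$. Perfect recall: if $h,h'$ are in the same $i$-information set and $h_1$ is a prefix of $h$ with $P(h_1)=i$, there is a prefix $h_1'$ of $h'$ in the same information set as $h_1$, and if $h_1\cdot\langle m\rangle$ is a prefix of $h$ then $h_1'\cdot\langle m\rangle$ is a prefix of $h'$. Components of $\Gamma^s$ carry superscript $s$. Virtual histories. For a tuple $\Gamma^+=(N^+,M^+,H^+,P^+,f_c^+,\{\mathcal{I}^+_i\},\{u_i^+\},\{A_i^+\}_{i\in N^+})$ the set $V^+$ of virtual histories is defined inductively: (1) if $\langle m\rangle\in H^+$, $m\in M^+\setminus M$, and either $P^+(\langle\rangle)\in N^+$ or $P^+(\langle\rangle)=c=P(\langle\rangle)$, then $\langle m\rangle\in V^+$; (2) if $h\cdot\langle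 m\rangle\in H^+$ and $h\in V^+$ then $h\cdot\langle m\rangle\in V^+$; (3) if $h\cdot\langle m\rangle\in H^+$, $m\in M^+\setminus M$, $h\notin V^+$, and either $P^+(h)\in N^+$ or $P^+(h)=c=P(\overline h)$, then $h\cdot\langle m\rangle\in V^+$. Here for $h\notin V^+$, $\overline h$ is the subsequence of moves of $h$ lying in $M$, and for $h\in V^+$, $\overline h=h$. Augmented games (with awareness of unawareness). An augmented game based on $\Gamma$ is such a $\Gamma^+$ satisfying: (A1) without the $A^+_i$ it is a finite extensive game with perfect recall; (A2) $A_i^+:H_i^+\to 2^H$, each $A_i^+(h)$ a prefix-closed set of histories of $\Gamma$; (A3) $N^+\subseteq N$; (A4$'$) if $P^+(h)\in N^+$ and $h\notin V^+$ then $P^+(h)=P(\overline h)$ and $M^+_h\subseteq M_{\overline h}\cup(M^+\setminus M)$; (A5$'$) if $P^+(h)=c$ and $h\notin V^+$ then either $P(\overline h)=c$ and $M^+_h\subseteq M_{\overline h}\cup(M^+\setminus M)$, or $P(\overline h)\neq c$ and $M^+_h\cap M=\emptyset$; (A6) $h,h'$ in the same information set of $\mathcal{I}^+_i$ implies $A^+_i(h)=A^+_i(h')$; (A7) if $h$ is a prefix of $h'$ and $P^+(h)=P^+(h')=i$ then $A^+_i(h)\subseteq A^+_i(h')$; (A8$'$) if $h,h'$ are in the same information set of $\Gamma^+$ and $h,h'\notin V^+$, then $\overline h,\overline{h'}$ are in the same information set of $\Gamma$; (A9) if $h,h'$ are histories of both $\Gamma^+$ and $\Gamma$ and are in the same information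 set of $\Gamma$, they are in the same information set of $\Gamma^+$; (A10) for $i\in N^+$, $h\in H_i^+$, if $h',h''\in A_i^+(h)$ are in the same information set of $\Gamma$ then $h'\cdot\langle m\rangle\in A_i^+(h)$ iff $h''\cdot\langle m\rangle\in A_i^+(h)$; (A12) for $i\in N^+$, $z\in Z^+$ with $\overline z\in Z$, $u^+_i(z)=u_i(\overline z)$. An augmented game without awareness of unawareness additionally satisfies (A4) if $P^+(h)\in N^+$ then $P^+(h)=P(\overline h)$ and $M^+_h\subseteq M_{\overline h}$; (A5) if $P^+(h)=c$ then either $P(\overline h)=c$ and $M^+_h\subseteq M_{\overline h}$, or $M^+_h\cap M=\emptyset$; (A8) $h,h'$ in the same information set of $\Gamma^+$ implies $\overline h,\overline{h'}$ in the same information set of $\Gamma$; (A11) $\{\overline z:z\in Z^+\}\subseteq Z$ and for $i\in N^+$, $h\in H^+_i$, every element of $A^+_i(h)$ not a strict prefix of another element of $A^+_i(h)$ lies in $Z$ (in such a game $V^+=\emptyset$). Games with awareness of unawareness. $\Gamma^*=(\mathcal{G},\Gamma^m,\mathcal{F})$ where $\mathcal{G}$ is a countable set of augmented games based on $\Gamma$, $\Gamma^m\in\mathcal{G}$ is an augmented game without awareness of unawareness satisfying (M1) $N^m=N$, (M2) $M\subseteq M^m$ and $\{\overline z:z\in Z^m\}=Z$, (M3) if $P^m(h)\in N$ then $M^m_h=M_{\overline h}$, and if $P^m(h)=c$ then either $M^m_h\cap M=\emptyset$ or ($M^m_h=M_{\overline h}$ and $f^m_c(\cdot\mid h)=f_c(\cdot\mid\overline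 h)$); and $\mathcal{F}$ maps each $(\Gamma^+,h)$ with $\Gamma^+\in\mathcal{G}$, $P^+(h)=i\in N^+$ to $(\Gamma^h,I)$, $\Gamma^h\in\mathcal{G}$, $I$ an $i$-information set of $\Gamma^h$, such that for all $\Gamma^+\in\mathcal{G}$, $h\in H^+$ with $P^+(h)=i$, $A_i^+(h)=a$, $\mathcal{F}(\Gamma^+,h)=(\Gamma^h,I)$: (C1$'$) $\{\overline{h'}:h'\in H^h,h'\notin V^h\}=a$; (C2$'$) if $h'\in H^h$ and $P^h(h')=j$ then (a) $A^h_j(h')\subseteq a$, (b) if $h'\notin V^h$ then $M^h_{h'}=(M_{\overline{h'}}\cap\{m:\overline{h'}\cdot\langle m\rangle\in a\})\cup(M^h_{h'}\setminus M_{\overline{h'}})$, (c) if $\mathcal{F}(\Gamma^h,h')=(\Gamma',I')$ then $M'_{h''}\subseteq M^h_{h'}$ for all $h''\in I'$; (C3) if $h'$ is in the same information set as $h$ in $\Gamma^+$ and $\overline{h'}\in a$, some $h''\in I$ has $\overline{h''}=\overline{h'}$; (C4) if $h'\in I$ then $A^h_i(h')=a$ and $\mathcal{F}(\Gamma^h,h')=(\Gamma^h,I)$; (C5) if $h'\in H^+$, $P^+(h')=i$, $A^+_i(h')=a$: if $h,h'$ are in the same information set of $\Gamma^+$ then $\mathcal{F}(\Gamma^+,h')=(\Gamma^h,I)$, and if $h$ is a prefix or suffix of $h'$ then $\mathcal{F}(\Gamma^+,h')=(\Gamma^h,I')$ for some $i$-information set $I'$; (C6$'$) if $h'\in I$,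 $h'\notin V^h$ and $h$ is not virtual, then $\overline h,\overline{h'}$ are in the same information set of $\Gamma$; (C7) if $\Gamma^h=\Gamma^+$ then $h'\in I$ iff $h,h'$ are in the same $i$-information set of $\Gamma^+$; (C8) for every $h'\in I$: a prefix $h'_1$ of $h'$ with $P^h(h'_1)=i$ and $\mathcal{F}(\Gamma^h,h'_1)=(\Gamma',I')$ exists iff a prefix $h_1$ of $h$ with $P^+(h_1)=i$ and $\mathcal{F}(\Gamma^+,h_1)=(\Gamma',I')$ exists; moreover $h'_1\cdot\langle m\rangle$ is a prefix of $h'$ iff $h_1\cdot\langle m\rangle$ is a prefix of $h$; (C9) some $h'\in I$ is such that for every prefix $h''\cdot\langle m\rangle$ of $h'$ with $P^h(h'')=j\in N^h$ and $\mathcal{F}(\Gamma^h,h'')=(\Gamma',I')$, $h_1\cdot\langle m\rangle\in H'$ for all $h_1\in I'$; (C10) histories of both $\Gamma^+$ and $\Gamma^h$ are in the same $i$-information set of $\Gamma^+$ iff they are in the same $i$-information set of $\Gamma^h$. Local strategies and equilibrium. $\mathcal{G}_i$ is the set of $\Gamma'\in\mathcal{G}$ with $\mathcal{F}(\Gamma^+,h)=(\Gamma',\cdot)$ for some $\Gamma^+\in\mathcal{G}$, $h$ with $P^+(h)=i$. $(\Gamma_1,h_1)\sim_i(\Gamma_2,h_2)$ iff $\mathcal{F}(\Gamma_1,h_1)=\mathcal{F}(\Gamma_2,h_2)$. A local strategy $\sigma_{i,\Gamma'}$ ($\Gamma'\in\mathcal{G}_i$) maps each $(\Gamma^+,h)$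 with $P^+(h)=i$, $\mathcal{F}(\Gamma^+,h)=(\Gamma',I)$ to a probability distribution over $M'_{h'}$ ($h'\in I$), constant on $\sim_i$-classes. A generalized strategy profile is $\vec\sigma=\{\sigma_{i,\Gamma'}:i\in N,\Gamma'\in\mathcal{G}_i\}$. $EU_{i,\Gamma'}(\vec\sigma)=\sum_{z\in Z'}\Pr(z)u'_i(z)$, where runs of $\Gamma'$ are generated by nature moving by $f'_c$ and, at $h$ with $P'(h)=j$, $\mathcal{F}(\Gamma',h)=(\Gamma'',\cdot)$, the move drawn from $\sigma_{j,\Gamma''}(\Gamma',h)$. $\vec\sigma^*$ is a generalized Nash equilibrium if for every $i$, $\Gamma'\in\mathcal{G}_i$ and local strategy $\sigma$ for $i$ in $\Gamma'$, $EU_{i,\Gamma'}(\vec\sigma^* )\ge EU_{i,\Gamma'}((\vec\sigma^*_{-(i,\Gamma')},\sigma))$. *)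

(* Defs.v *)
From HB Require Import structures.
From mathcomp Require Import all_boot all_order all_algebra.
From mathcomp Require Import reals.
Set Implicit Arguments. Unset Strict Implicit. Unset Printing Implicit Defensive.
Import Order.TTheory GRing.Theory Num.Theory.
Local Open Scope ring_scope.

(* Encoding.  All games share an ambient type of moves [Mv]; each game     *)
(* carries its own finite set of moves [xM].  Players are natural numbers; *)
(* the player function returns [None] for nature (c).  Histories are       *)
(* [seq Mv]; h.<m> is [rcons h m].  Finite sets are sequences (read as     *)
(* sets, via membership).  The information partition of a game is given by *)
(* a relation [xsame] ("in the same information set"); a cell is a class.  *)
(* [xA i h] is the awareness set A_i(h) (unused for the underlying game).  *)

Section Games.
Variables (Mv : eqType) (R : realType).

Record xgame := XGame {
  xN : seq nat;
  xM : seq Mv;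
  xH : seq (seq Mv);
  xP : seq Mv -> option nat;          (* None = nature *)
  xfc : seq Mv -> Mv -> R;
  xsame : seq Mv -> seq Mv -> bool;
  xu : nat -> seq Mv -> R;
  xA : nat -> seq Mv -> seq (seq Mv)
}.

Definition strict_prefix (h h' : seq Mv) := prefix h h' && (h != h').

Definition term (a : xgame) (h : seq Mv) :=
  (h \in xH a) && ~~ has (strict_prefix h) (xH a).

Definition plays (a : xgame) (h : seq Mv) (o : option nat) :=
  [&& h \in xH a, ~~ term a h & xP a h == o].

Definition movesAt (a : xgame) (h : seq Mv) :=
  undup [seq m <- xM a | rcons h m \in xH a].

Definition info_wf (a : xgame) : Prop :=
  [/\ (forall h h', xsame a h h' ->
         exists i, plays a h (Some i) /\ plays a h' (Some i)),
      (forall h i, plays a h (Some i) -> xsame a h h),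
      (forall h h', xsame a h h' -> xsame a h' h),
      (forall h1 h2 h3, xsame a h1 h2 -> xsame a h2 h3 -> xsame a h1 h3)
    & (forall h h' m, xsame a h h' ->
         (rcons h m \in xH a) = (rcons h' m \in xH a))].

Definition perfect_recall (a : xgame) : Prop :=
  forall i h h' h1, xsame a h h' -> plays a h (Some i) ->
    prefix h1 h -> plays a h1 (Some i) ->
    exists h1', [/\ prefix h1' h', xsame a h1 h1' &
      forall m, prefix (rcons h1 m) h -> prefix (rcons h1' m) h'].

Definition wf_game (a : xgame) : Prop :=
  [::] \in xH a /\
      (forall h h', h' \in xH a -> prefix h h' -> h \in xH a) /\
      (forall h, h \in xH a -> {subset h <= xM a}) /\
      (forall h i, plays a h (Some i) -> i \in xN a) /\
      (forall h, plays a h None ->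
         (forall m, 0 <= xfc a h m) /\ \sum_(m <- movesAt a h) xfc a h m = 1) /\
      info_wf a /\
      perfect_recall a.

(* Clause (3) of the inductive definition (clause (1) is its instance       *)
(* h = <>, since <> is never virtual and its bar is <>).                    *)
Definition trig (g a : xgame) (h : seq Mv) (m : Mv) :=
  [&& m \in xM a, m \notin xM g &
      if xP a h is Some i then i \in xN a
      else plays g [seq x <- h | x \in xM g] None].

(* stratified (by length) reading of the inductive definition; r = rev h *)
Fixpoint vrev (g a : xgame) (r : seq Mv) : bool :=
  match r with
  | [::] => false
  | m :: r' => (rcons (rev r') m \in xH a) &&
      (vrev g a r' || (trig g a (rev r') m && ~~ vrev g a r'))
  end.

Definition virt (g a : xgame) (h : seq Mv) := vrev g a (rev h).

Definition bar (g a : xgame) (h : seq Mv) :=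
  if virt g a h then h else [seq x <- h | x \in xM g].

Section Aug.
Variables (g a : xgame).
Local Notation bar := (bar g a).
Local Notation virt := (virt g a).

Definition A2 := forall i h, plays a h (Some i) ->
  {subset xA a i h <= xH g} /\
  (forall h1 h2, h2 \in xA a i h -> prefix h1 h2 -> h1 \in xA a i h).
Definition A3 := {subset xN a <= xN g}.
Definition A4' := forall i h, plays a h (Some i) -> ~~ virt h ->
  plays g (bar h) (Some i) /\
  (forall m, rcons h m \in xH a ->
     (rcons (bar h) m \in xH g) || ((m \in xM a) && (m \notin xM g))).
Definition A5' := forall h, plays a h None -> ~~ virt h ->
  (plays g (bar h) None /\
    (forall m, rcons h m \in xH a ->
       (rcons (bar h) m \in xH g) || ((m \in xM a) && (m \notin xM g))))
  \/ (~~ plays g (bar h) None /\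
    (forall m, rcons h m \in xH a -> m \notin xM g)).
Definition A6 := forall i h h', plays a h (Some i) -> xsame a h h' ->
  xA a i h =i xA a i h'.
Definition A7 := forall i h h', prefix h h' -> plays a h (Some i) ->
  plays a h' (Some i) -> {subset xA a i h <= xA a i h'}.
Definition A8' := forall h h', xsame a h h' -> ~~ virt h -> ~~ virt h' ->
  xsame g (bar h) (bar h').
Definition A9 := forall h h', h \in xH a -> h \in xH g -> h' \in xH a ->
  h' \in xH g -> xsame g h h' -> xsame a h h'.
Definition A10 := forall i h, i \in xN a -> plays a h (Some i) ->
  forall h' h'', h' \in xA a i h -> h'' \in xA a i h -> xsame g h' h'' ->
  forall m, (rcons h' m \in xA a i h) = (rcons h'' m \in xA a i h).
Definition A12 := forall i z, i \in xN a -> term a z -> term g (bar z) ->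
  xu a i z = xu g i (bar z).

Definition augmented : Prop :=
  wf_game a /\ A2 /\ A3 /\ A4' /\ A5' /\ A6 /\ A7 /\ A8' /\ A9 /\ A10 /\ A12.

Definition A4 := forall i h, plays a h (Some i) ->
  plays g (bar h) (Some i) /\
  (forall m, rcons h m \in xH a -> rcons (bar h) m \in xH g).
Definition A5 := forall h, plays a h None ->
  (plays g (bar h) None /\
    (forall m, rcons h m \in xH a -> rcons (bar h) m \in xH g))
  \/ (forall m, rcons h m \in xH a -> m \notin xM g).
Definition A8 := forall h h', xsame a h h' -> xsame g (bar h) (bar h').
Definition A11 :=
  (forall z, term a z -> term g (bar z)) /\
  (forall i h, i \in xN a -> plays a h (Some i) ->
     forall h', h' \in xA a i h ->
       (forall h'', h'' \in xA a i h -> ~~ strict_prefix h' h'') ->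
       term g h').

Definition augmented_noaou : Prop := augmented /\ A4 /\ A5 /\ A8 /\ A11.
End Aug.

(* G indexes the countable collection of augmented games (gam : G -> xgame),
   m0 indexes Gamma^m, and F x h = (index of Gamma^h, information set I). *)
Section GAWU.
Variables (G : countType) (g : xgame) (gam : G -> xgame) (m0 : G)
          (F : G -> seq Mv -> G * seq (seq Mv)).

Definition Feq (p q : G * seq (seq Mv)) := p.1 = q.1 /\ p.2 =i q.2.

Definition is_infoset (a : xgame) (i : nat) (I : seq (seq Mv)) :=
  exists h0, plays a h0 (Some i) /\ forall h', (h' \in I) = xsame a h0 h'.

Definition cond_M : Prop :=
  let gm := gam m0 in
  [/\ xN gm =i xN g,
      {subset xM g <= xM gm},
      (forall z, term gm z -> term g (bar g gm z)),
      (forall z, term g z -> exists2 z', term gm z' & bar g gm z' = z)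
    & (forall h,
        ((exists i, plays gm h (Some i) /\ i \in xN g) ->
           forall m, (rcons h m \in xH gm) = (rcons (bar g gm h) m \in xH g)) /\
        (plays gm h None ->
           (forall m, rcons h m \in xH gm -> m \notin xM g) \/
           ((forall m, (rcons h m \in xH gm) = (rcons (bar g gm h) m \in xH g)) /\
            (forall m, rcons (bar g gm h) m \in xH g ->
               xfc gm h m = xfc g (bar g gm h) m))))].

Definition cond_F (x : G) (h : seq Mv) (i : nat) : Prop :=
  let Gx := gam x in
  let a := xA Gx i h in
  let y := (F x h).1 in
  let I := (F x h).2 in
  let Gy := gam y in
  is_infoset Gy i I /\
    (forall h', (exists h'', [/\ h'' \in xH Gy, ~~ virt g Gy h'' &
                               bar g Gy h'' = h']) <-> h' \in a) /\
    (forall h' j, plays Gy h' (Some j) ->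
       [/\ {subset xA Gy j h' <= a},
           (~~ virt g Gy h' -> forall m,
              (rcons h' m \in xH Gy) <->
              ((rcons (bar g Gy h') m \in xH g) && (rcons (bar g Gy h') m \in a))
              \/ ((rcons h' m \in xH Gy) && (rcons (bar g Gy h') m \notin xH g)))
         & (forall h'' m, h'' \in (F y h').2 ->
              rcons h'' m \in xH (gam (F y h').1) -> rcons h' m \in xH Gy)]) /\
    (forall h', xsame Gx h h' -> bar g Gx h' \in a ->
       exists2 h'', h'' \in I & bar g Gy h'' = bar g Gx h') /\
    (forall h', h' \in I -> xA Gy i h' =i a /\ Feq (F y h') (F x h)) /\
    (forall h', plays Gx h' (Some i) -> xA Gx i h' =i a ->
       (xsame Gx h h' -> Feq (F x h') (F x h)) /\
       (prefix h h' \/ prefix h' h -> (F x h').1 = y)) /\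
    (forall h', h' \in I -> ~~ virt g Gy h' -> ~~ virt g Gx h ->
       xsame g (bar g Gx h) (bar g Gy h')) /\
    (y = x -> forall h', h' \in I <-> xsame Gx h h') /\
    (forall h', h' \in I ->
       (forall p, (exists h1', [/\ prefix h1' h', plays Gy h1' (Some i) &
                                   Feq (F y h1') p]) <->
                  (exists h1, [/\ prefix h1 h, plays Gx h1 (Some i) &
                                  Feq (F x h1) p])) /\
       (forall h1' h1, prefix h1' h' -> plays Gy h1' (Some i) ->
          prefix h1 h -> plays Gx h1 (Some i) -> Feq (F y h1') (F x h1) ->
          forall m, prefix (rcons h1' m) h' <-> prefix (rcons h1 m) h)) /\
    (exists2 h', h' \in I &
       forall h'' m j, prefix (rcons h'' m) h' -> plays Gy h'' (Some j) ->
         j \in xN Gy ->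
         forall h1, h1 \in (F y h'').2 -> rcons h1 m \in xH (gam (F y h'').1)) /\
    (forall h1 h2, h1 \in xH Gx -> h1 \in xH Gy -> h2 \in xH Gx ->
       h2 \in xH Gy ->
       (xsame Gx h1 h2 && plays Gx h1 (Some i)) =
       (xsame Gy h1 h2 && plays Gy h1 (Some i))).

Definition game_awareness_unawareness : Prop :=
  [/\ forall x, augmented g (gam x),
      augmented_noaou g (gam m0),
      cond_M
    & forall x h i, plays (gam x) h (Some i) -> i \in xN (gam x) ->
        cond_F x h i].

Definition inGi (i : nat) (y : G) :=
  exists x h, plays (gam x) h (Some i) /\ (F x h).1 = y.

Definition movesI (a : xgame) (I : seq (seq Mv)) :=
  undup (flatten [seq movesAt a h' | h' <- I]).

Definition is_dist (s : seq Mv) (p : Mv -> R) :=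
  [/\ forall m, 0 <= p m, forall m, m \notin s -> p m = 0
    & \sum_(m <- s) p m = 1].

Definition local_strategy (i : nat) (y : G) (tau : G -> seq Mv -> Mv -> R) :=
  forall x h, plays (gam x) h (Some i) -> (F x h).1 = y ->
    is_dist (movesI (gam y) (F x h).2) (tau x h) /\
    (forall x' h', plays (gam x') h' (Some i) -> Feq (F x h) (F x' h') ->
       tau x h =1 tau x' h').

(* generalized strategy profile: sigma i y = sigma_{i,y} *)
Definition profile := nat -> G -> G -> seq Mv -> Mv -> R.

Definition step (sigma : profile) (y : G) (h : seq Mv) (m : Mv) : R :=
  match xP (gam y) h with
  | None => xfc (gam y) h m
  | Some j => sigma j (F y h).1 y h m
  end.

Fixpoint probr (sigma : profile) (y : G) (r : seq Mv) : R :=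
  match r with
  | [::] => 1
  | m :: r' => probr sigma y r' * step sigma y (rev r') m
  end.

Definition EU (sigma : profile) (i : nat) (y : G) : R :=
  \sum_(z <- undup [seq z <- xH (gam y) | term (gam y) z])
     probr sigma y (rev z) * xu (gam y) i z.

Definition update (sigma : profile) (i : nat) (y : G)
  (tau : G -> seq Mv -> Mv -> R) : profile :=
  fun j y' => if (j == i) && (y' == y) then tau else sigma j y'.

Definition generalized_nash (sigma : profile) : Prop :=
  (forall i y, i \in xN g -> inGi i y -> local_strategy i y (sigma i y)) /\
  (forall i y tau, i \in xN g -> inGi i y -> local_strategy i y tau ->
     EU (update sigma i y tau) i y <= EU sigma i y).
End GAWU.
End Games.

(* Main.v *)
(* The strategies are encoded by a point of the cube [0,1]^T with T countable:
   at each information set of each augmented game, the moves are listed, and one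
   coordinate per move gives the probability of stopping at that move when the
   previous ones have been passed (stick breaking).
   For functions G_c on the cube, continuous for pointwise convergence, there is
   a point u with u_c G_c(u) >= 0 and (1 - u_c) G_c(u) <= 0 for all c: Kuhn's
   cubical lemma on the first n coordinates, with mesh 1/(n+1), gives approximate
   solutions, and an ultrafilter limit handles all the games at once.
   Kuhn's lemma itself is a mod 2 Stokes formula: the cup product of the
   coboundaries of the labels is exact, hence its sum over all the cells is a
   boundary term, which is 1; a cell with a nonzero contribution sees both values
   of every label.
   Taking for G_c the counterfactual gain of stopping over passing, u yields a
   profile whose behaviour at every information set maximizes the counterfactual
   value, whether or not the set is reached. By perfect recall the own reach
   probability is constant on information sets, and the performance difference
   formula turns local optimality into optimality against every deviation of a
   local strategy. *)

Require Import Defs.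
From HB Require Import structures.
From mathcomp Require Import all_boot all_order all_algebra.
From mathcomp Require Import reals.
From mathcomp Require Import all_classical all_reals all_analysis.
From mathcomp Require Import ring.
Set Implicit Arguments. Unset Strict Implicit. Unset Printing Implicit Defensive.
Import Order.TTheory GRing.Theory Num.Theory numFieldNormedType.Exports.
Local Open Scope ring_scope.

(** * Kuhn's cubical lemma *)

Section KuhnLemma.
(* Instantiated with ['F_2]; kept abstract because unification tends to unfold
   the concrete ring. *)
Variables (K : comNzRingType) (K2 : 2%N \in [pchar K]).
Variables (d p : nat) (l : nat -> {ffun 'I_d -> 'I_p.+1} -> bool).
Local Notation point := {ffun 'I_d -> 'I_p.+1}.

Definition succ_at (c : 'I_d) (x : point) : point :=
  [ffun j => if j == c then ordS (x j) else x j].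

Lemma succ_at_bij c : bijective (succ_at c).
Proof.
exists (fun x : point => [ffun j => if j == c then ord_pred (x j) else x j]) => x;
  apply/ffunP => j; rewrite !ffunE; case: eqP => // _; by rewrite ?ordSK ?ord_predK.
Qed.

Lemma succ_atC c e x : succ_at c (succ_at e x) = succ_at e (succ_at c x).
Proof. by apply/ffunP => j; rewrite !ffunE; case: eqP => //; case: eqP. Qed.

Local Notation lab k x := ((l k x)%:R : K).

Lemma addFF (x : K) : x + x = 0.
Proof. exact: addrr_pchar2. Qed.

(* [omega k] is the cubical cup product [dl_(k-1) u ... u dl_0] of the mod 2
   coboundaries of the labels, evaluated on the cube at [x] with directions [S].
   The grid is a torus: [succ_at] wraps from [p] to [0]. *)
Fixpoint omega (k : nat) (x : point) (S : {set 'I_d}) : K :=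
  if k is k'.+1 then
    \sum_(c in S) (lab k' (succ_at c x) + lab k' x) * omega k' (succ_at c x) (S :\ c)
  else (S == finset.set0)%:R.

Definition cobord (w : point -> {set 'I_d} -> K) x (S : {set 'I_d}) :=
  \sum_(c in S) (w (succ_at c x) (S :\ c) + w x (S :\ c)).

Lemma cobordM (f : point -> K) w x S :
  cobord (fun x S => f x * w x S) x S =
  \sum_(c in S) (f (succ_at c x) + f x) * w (succ_at c x) (S :\ c) + f x * cobord w x S.
Proof.
rewrite /cobord mulr_sumr -big_split; apply: eq_bigr => c _ /=.
rewrite mulrDl mulrDr -!addrA; congr (_ + _).
by rewrite addrA addFF add0r.
Qed.

(** The diagonal is left out, and the pairs [(c, e)] and [(e, c)] cancel in characteristic 2. *)
Lemma sum_sym0 (S : {set 'I_d}) (f : 'I_d -> 'I_d -> K) :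
  (forall c e, f c e = f e c) -> \sum_(c in S) \sum_(e in S :\ c) f c e = 0.
Proof.
move=> fC.
have -> : \sum_(c in S) \sum_(e in S :\ c) f c e =
  \sum_(c in S) \sum_(e in S | (e < c)%N) f c e +
  \sum_(c in S) \sum_(e in S | (c < e)%N) f c e.
  rewrite -big_split; apply: eq_bigr => c _ /=.
  rewrite (bigID (fun e : 'I_d => (e < c)%N)) /=; congr (_ + _); apply: eq_bigl => e.
    rewrite !inE; case: (e \in S); rewrite ?andbF //= andbT.
    by case: eqP => // ->; rewrite ltnn.
  rewrite !inE; case: (e \in S); rewrite ?andbF //= andbT.
  by rewrite -leqNgt ltn_neqAle eq_sym.
rewrite (exchange_big_dep (fun e => e \in S)) /=; last by move=> ? ? _ /andP[].
rewrite [X in X + _](_ : _ = \sum_(c in S) \sum_(e in S | (c < e)%N) f c e).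
  exact: addFF.
apply: eq_bigr => c cS; apply: eq_big => [e|e _]; last exact: fC.
by rewrite cS.
Qed.

(** Shifts commute and directions can be removed in either order, so the four terms of the expansion
    group into [f] and [g], each symmetric in the two directions. *)
Lemma cobordK w x S : cobord (cobord w) x S = 0.
Proof.
rewrite /cobord.
pose f c e := w (succ_at e (succ_at c x)) (S :\ c :\ e) + w x (S :\ c :\ e).
pose g c e := w (succ_at c x) (S :\ c :\ e) + w (succ_at e x) (S :\ c :\ e).
have SC c e : S :\ c :\ e = S :\ e :\ c.
  by apply/finset.setP => j; rewrite !inE andbCA.
rewrite (eq_bigr (fun c => \sum_(e in S :\ c) f c e + \sum_(e in S :\ c) g c e)).
  rewrite big_split /= (sum_sym0 S (f := f)) ?(sum_sym0 S (f := g)) ?addr0 // => c e.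
    by rewrite /g (SC c e) addrC.
  by rewrite /f (SC c e) succ_atC.
move=> c _; rewrite -!big_split; apply: eq_bigr => e _; rewrite /f /g /=.
by rewrite [w (succ_at e x) _ + w x _]addrC addrACA.
Qed.

Lemma omegaE k x S :
  cobord (omega k) x S = 0 ->
  omega k.+1 x S = cobord (fun x S => lab k x * omega k x S) x S.
Proof. by move=> c0; rewrite cobordM c0 mulr0 addr0. Qed.

(** Once [omega k] is closed, the Leibniz rule makes [omega k.+1] a coboundary, hence closed in
    turn. *)
Lemma omega_closed k x S : cobord (omega k) x S = 0.
Proof.
elim: k x S => [|k IH] x S.
  by rewrite /cobord big1 // => c _; rewrite addFF.
rewrite -(cobordK (fun x S => lab k x * omega k x S) x S) /cobord.
by apply: eq_bigr => c _; rewrite !(omegaE (IH _ _)).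
Qed.

Definition cell (x : point) (S : {set 'I_d}) (y : point) :=
  forall i, y i = x i \/ (i \in S /\ y i = ordS (x i)).

(** The factor contributed by label [j] is a difference of equal values. The factors of higher
    labels are peeled off first, each step passing to a subcell. *)
Lemma omega_const k j x S b : (j < k)%N ->
  (forall y, cell x S y -> l j y = b) -> omega k x S = 0.
Proof.
elim: k x S => // k IH x S jk lb /=; apply: big1 => c cS.
move: jk; rewrite ltnS leq_eqVlt => /orP[/eqP <-|jk].
  rewrite !lb ?addFF ?mul0r // => i; first by left.
  by rewrite ffunE; case: eqP => [->|_]; [right|left].
rewrite IH ?mulr0 // => y yc; apply: lb => i.
have := yc i; rewrite !inE ffunE; case: eqP => [->|_] /=.
  by case=> [->|[]//]; right.
by case=> [|[]]; [left|right].
Qed.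

Hypothesis p_gt0 : (0 < p)%N.
Hypothesis l0 : forall (j : 'I_d) (x : point), x j = ord0 -> l j x = false.
Hypothesis l1 : forall (j : 'I_d) (x : point), x j = ord_max -> l j x = true.

(** Selects the lower corners of the [k]-cubes that do not wrap around the torus, inside the face of
    the grid where all coordinates from [k] on are maximal. *)
Definition inface k (j : 'I_d) (a : 'I_p.+1) :=
  if (j < k)%N then a != ord_max else a == ord_max.
Definition face k (x : point) := [forall j, inface k j (x j)].
Definition below k : {set 'I_d} := [set j : 'I_d | (j < k)%N].

(* Discrete Stokes: only the faces on which coordinate [c] is extremal
   survive the telescoping in direction [c], and on those the form [omega]
   vanishes unless [c] is the coordinate of the last label. *)
Lemma sum_omega k : (k <= d)%N -> \sum_(x | face k x) omega k x (below k) = 1.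
Proof.
elim: k => [|k IH] kd.
  rewrite (big_pred1 [ffun=> ord_max]) /=.
    rewrite (_ : below 0 == finset.set0) //; apply/eqP/finset.setP => j; by rewrite !inE.
  move=> x; apply/forallP/eqP => [fx|-> j]; last by rewrite /inface ffunE /= eqxx.
  by apply/ffunP => j; rewrite ffunE; apply/eqP; have := fx j.
pose eta x S := lab k x * omega k x S.
rewrite (eq_bigr (fun x => cobord eta x (below k.+1))); last first.
  by move=> x _; rewrite (omegaE (omega_closed _ _ _)).
rewrite /cobord exchange_big /=.
pose ck := Ordinal kd.
pose Y c (x : point) := [forall (j | j != c), inface k.+1 j (x j)].
have faceE c x : c \in below k.+1 -> face k.+1 x = Y c x && (x c != ord_max).
  rewrite inE => ck1; apply/forallP/andP => [fx|[/forall_inP Yx xc] j].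
    split; first by apply/forall_inP => j _; exact: fx.
    by have := fx c; rewrite /inface ck1.
  by have [->|/Yx//] := eqVneq j c; rewrite /inface ck1.
have Ysh c x : Y c (succ_at c x) = Y c x.
  apply: eq_forallb => j; case: eqP => //= jc; rewrite ffunE.
  by case: eqP.
have shc (c : 'I_d) (x : point) : (succ_at c x c != ord0) = (x c != ord_max).
  rewrite ffunE eqxx; congr (~~ _).
  rewrite -[ord0](_ : @ordS p.+1 ord_max = ord0); last first.
    by apply: val_inj => /=; rewrite modnn.
  exact: (inj_eq (can_inj (@ordSK _))).
(* Reindexing the shifted half by [succ_at c] turns the condition [x c != ord_max] into
   [x c != ord0]; a point with [x c] strictly in between is then counted twice and cancels. *)
rewrite (eq_bigr (fun c => \sum_(x | Y c x)
   ((x c == ord0)%:R + (x c == ord_max)%:R) * eta x (below k.+1 :\ c))); last first.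
  move=> c cS; rewrite big_split /=.
  rewrite (eq_bigl (fun x => Y c (succ_at c x) && (succ_at c x c != ord0))); last first.
    by move=> x; rewrite (faceE c) // Ysh shc.
  rewrite -(reindex (succ_at c) (P := fun x => Y c x && (x c != ord0))
     (F := fun x => eta x (below k.+1 :\ c))) /=; last exact/onW_bij/succ_at_bij.
  rewrite (eq_bigl _ _ (fun x => faceE c x cS)).
  rewrite 2!big_mkcondr -big_split; apply: eq_bigr => x _ /=.
  by case: (x c == ord0); case: (x c == ord_max);
    rewrite /= ?mul0r ?addFF ?add0r ?addr0 ?mul0r ?mul1r.
rewrite (bigD1 ck) ?inE //= [X in _ + X]big1 ?addr0; last first.
  move=> c; rewrite inE => /andP[ck1 cck]; apply: big1 => x _.
  have ck' : (c < k)%N.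
    by rewrite ltn_neqAle -ltnS ck1 andbT; apply: contra cck => /eqP ce; apply/eqP/val_inj.
  rewrite /eta; have [x0|] := eqVneq (x c) ord0.
    rewrite (@omega_const k c x (below k.+1 :\ c) false) ?mulr0 // => y yc.
    by apply: l0; have := yc c; rewrite !inE eqxx => -[->|[]].
  have [x1|] := eqVneq (x c) ord_max; last by rewrite addr0 mul0r.
  rewrite (@omega_const k c x (below k.+1 :\ c) true) ?mulr0 // => y yc.
  by apply: l1; have := yc c; rewrite !inE eqxx => -[->|[]].
have -> : below k.+1 :\ ck = below k.
  by apply/finset.setP => j; rewrite !inE ltnS [RHS]ltn_neqAle -(inj_eq val_inj).
apply: etrans (IH (ltnW kd)).
have neqk (j : 'I_d) : j != ck -> (nat_of_ord j == k) = false.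
  by move=> jc; apply: contraNF jc => /eqP je; apply/eqP/val_inj.
have fE x : face k x = Y ck x && (x ck == ord_max).
  apply/forallP/andP => [fx|[/forall_inP Yx xc] j].
    split; last by have := fx ck; rewrite /inface /= ltnn.
    apply/forall_inP => j jc; have := fx j; rewrite /inface ltnS [(j <= k)%N]leq_eqVlt.
    by rewrite neqk.
  have [->|jc] := eqVneq j ck; first by rewrite /inface /= ltnn.
  have := Yx _ jc; rewrite /inface ltnS [(j <= k)%N]leq_eqVlt.
  by rewrite neqk.
(* In direction [ck] the last label is 0 on the lower face and 1 on the upper one, where [eta]
   reduces to [omega k]. *)
rewrite [RHS](eq_bigl _ _ fE) big_mkcondr; apply: eq_bigr => x _.
rewrite /eta; have [x1|] := eqVneq (x ck) ord_max.
  rewrite x1 (l1 x1) (_ : (ord_max == ord0 :> 'I_p.+1) = false) ?add0r ?mul1r //.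
  by apply/negbTE/eqP => /(congr1 val) /= p0; have := p_gt0; rewrite p0.
have [x0|] := eqVneq (x ck) ord0; last by rewrite addr0 mul0r.
by rewrite (l0 x0) mul0r mulr0.
Qed.

Theorem kuhn_lemma : exists q : point, (forall j, q j < p)%N /\
  forall j : 'I_d, exists r s,
    [/\ cell q [set: 'I_d]%SET r, cell q [set: 'I_d]%SET s, ~~ l j r & l j s].
Proof.
have [q] : exists q, face d q && (omega d q [set: 'I_d]%SET != 0).
  apply/existsP; apply: contraT => /existsPn no.
  have := sum_omega (leqnn d); rewrite (_ : below d = [set: 'I_d]%SET); last first.
    by apply/finset.setP => j; rewrite !inE ltn_ord.
  rewrite big1 => [|x fx]; first by move/eqP; rewrite eq_sym oner_eq0.
  by have := no x; rewrite fx negbK => /eqP.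
case/andP=> /forallP fq wq; exists q; split=> j.
  have := fq j; rewrite /inface ltn_ord => qj.
  rewrite ltn_neqAle -ltnS ltn_ord andbT; apply: contra qj => /eqP e.
  exact/eqP/val_inj.
have ex b : exists y, cell q [set: 'I_d]%SET y /\ l j y = ~~ b.
  pose cb (y : point) := [forall i, (y i == q i) || (y i == ordS (q i))].
  have cbP y : cb y -> cell q [set: 'I_d]%SET y.
    by move/forallP => h i; case/orP: (h i) => /eqP ->; [left|right; rewrite inE].
  have [/existsP[y /andP[/cbP yc ly]]|/existsPn no] := boolP [exists y, cb y && (l j y != b)].
    by exists y; split => //; move: ly; case: (l j y); case: b.
  case/negP: wq; apply/eqP/(@omega_const _ j _ _ b) => // y yc; apply/eqP.
  have := no y; rewrite negb_and negbK => /orP[/forallP[]|//] i.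
  by case: (yc i) => [->|[_ ->]]; rewrite eqxx ?orbT.
have [r [rc lr]] := ex true; have [s [sc ls]] := ex false.
by exists r, s; split => //; rewrite ?lr ?ls.
Qed.
End KuhnLemma.

(** * Complementarity on the cube *)

Local Open Scope classical_set_scope.

(** Compactness gives a cluster point. It is a limit, since the preimage of a neighbourhood or its
    complement lies in [U], and the latter contradicts clustering. *)
Lemma ultra_cvg (R : realType) (U : set_system nat) (v : nat -> R) :
  UltraFilter U -> (forall n, 0 <= v n <= 1) -> exists u : R, v n @[n --> U] --> u.
Proof.
move=> UU v01.
have FU : ProperFilter U by exact: ultra_proper.
have [u [_ cu]] : `[0 : R, 1] `&` cluster (v n @[n --> U]) !=set0.
  apply: (@segment_compact R 0 1); apply: nearW => n /=.
  by rewrite in_itv /=.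
exists u => B Bu; have [//|nB] := in_ultra_setVsetC (v @^-1` B) UU.
by have [y [nBy By]] := cu (~` B) B nB Bu.
Qed.

Section BoxComplementarity.
Variables (R : realType) (T : countType) (G : T -> (T -> R) -> R).
Hypothesis G_continuous : forall U : set_system nat, ProperFilter U ->
  forall (v : nat -> T -> R) (u : T -> R),
  (forall c, v n c @[n --> U] --> u c) ->
  forall c, G c (v n) @[n --> U] --> G c u.

Definition in_box (v : T -> R) := forall c, 0 <= v c <= 1.

Lemma approx_complementarity (n : nat) : exists v : T -> R, in_box v /\
  forall c, (pickle c < n)%N -> exists r s : T -> R,
    [/\ forall c', `|r c' - v c'| <= n.+1%:R^-1,
        forall c', `|s c' - v c'| <= n.+1%:R^-1,
        0 <= r c * G c r & (1 - s c) * G c s <= 0].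
Proof.
(* The grid values are 0, ..., [n.+1], so that [p = n.+1] is positive even for [n = 0]; coordinates
   with code at least [n] are set to 0. *)
pose pt (x : {ffun 'I_n -> 'I_n.+2}) (c : T) : R :=
  if insub (pickle c) is Some j then (x j : nat)%:R / n.+1%:R else 0.
have ptE x c (j : 'I_n) : pickle c = j -> pt x c = (x j : nat)%:R / n.+1%:R.
  by move=> e; rewrite /pt e valK.
(* The label records the sign of [G c], corrected at the ends: false means coordinate 0 or
   [G c >= 0], true means coordinate 1 or [G c < 0]. These are the two desired inequalities. *)
pose l (j : nat) (x : {ffun 'I_n -> 'I_n.+2}) : bool :=
  if (insub j : option 'I_n) is Some j' then
    (x j' == ord_max) || ((x j' != ord0) &&
      (if @pickle_inv T j is Some c then G c (pt x) < 0 else false))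
  else false.
have lE (j : 'I_n) x : l j x = (x j == ord_max) || ((x j != ord0) &&
      (if @pickle_inv T j is Some c then G c (pt x) < 0 else false)).
  by rewrite /l valK.
have l0 (j : 'I_n) (x : {ffun 'I_n -> 'I_n.+2}) : x j = ord0 -> l j x = false.
  by move=> x0; rewrite lE x0.
have l1 (j : 'I_n) (x : {ffun 'I_n -> 'I_n.+2}) : x j = ord_max -> l j x = true.
  by move=> x0; rewrite lE x0 eqxx.
have [q [qn qP]] := kuhn_lemma (pchar_Fp (isT : prime 2)) (ltn0Sn n) l0 l1.
have n0 : 0 < n.+1%:R :> R by rewrite ltr0n.
exists (pt q); split=> [c|c cn].
  rewrite /pt; case: insubP => [j _ _|_]; last by rewrite lexx ler01.
  by rewrite divr_ge0 //= ler_pdivrMr // mul1r ler_nat -ltnS.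
have dist y : cell q [set: 'I_n]%SET y -> forall c', `|pt y c' - pt q c'| <= n.+1%:R^-1.
  move=> yc c'; rewrite /pt; case: insubP => [j _ _|_]; last first.
    by rewrite subrr normr0 invr_ge0 ltW.
  case: (yc j) => [->|[_ ->]]; first by rewrite subrr normr0 invr_ge0 ltW.
  rewrite -mulrBl normrM normfV (ger0_norm (ltW n0)) ler_piMl ?invr_ge0 ?(ltW n0) //=.
  (* The bound [q j < p] excludes the wrap-around of [ordS], so neighbours differ by one mesh
     step. *)
  rewrite modn_small ?ltnS //; last exact: qn.
  by rewrite -natrB // subSnn normr1.
have [r [s [rc sc lr ls]]] := qP (Ordinal cn).
have inv : @pickle_inv T (Ordinal cn) = Some c by exact: pickleK_inv.
exists (pt r), (pt s); split; [exact: dist|exact: dist| |].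
  move: lr; rewrite lE inv negb_or negb_and negbK -leNgt => /andP[_].
  rewrite (ptE _ _ (Ordinal cn)) // => /orP[/eqP->|g0]; first by rewrite !mul0r.
  by rewrite mulr_ge0 // divr_ge0.
move: ls; rewrite lE inv (ptE _ _ (Ordinal cn)) // => /orP[/eqP->|/andP[_ g0]].
  by rewrite /= divff ?subrr ?mul0r // gt_eqF.
rewrite mulr_ge0_le0 ?(ltW g0) // subr_ge0 ler_pdivrMr // mul1r ler_nat -ltnS.
exact: ltn_ord.
Qed.

Theorem box_complementarity : exists u : T -> R, in_box u /\
  forall c, 0 <= u c * G c u /\ (1 - u c) * G c u <= 0.
Proof.
have [v vP] := choice approx_complementarity.
have [U [UU ooU]] := ultraFilterLemma (F := \oo) _.
have FU : ProperFilter U by exact: ultra_proper.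
have [u uP] := choice (fun c => ultra_cvg UU (fun n => (vP n).1 c)).
have lim0 : n.+1%:R^-1 @[n --> U] --> (0 : R).
  by move=> A /cvg_harmonic; exact: ooU.
have close (w : nat -> T -> R) : (\forall n \near U, forall c, `|w n c - v n c| <= n.+1%:R^-1) ->
    forall c, w n c @[n --> U] --> u c.
  move=> wv c; rewrite -[u c]add0r.
  rewrite (_ : (fun n => w n c) = (fun n => (w n c - v n c) + v n c)); last first.
    by apply/funext => n; rewrite subrK.
  apply: cvgD; last exact: uP.
  apply: norm_cvg0; apply: (squeeze_cvgr (f := fun=> 0) (h := fun n => n.+1%:R^-1)) => //.
    by near=> n; rewrite normr_ge0 /=; near: n; apply: filterS wv => n; exact.
  exact: cvg_cst.
exists u; split=> c.
  apply/andP; split.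
    by apply: (cvgr_to_ge (uP c)); apply: nearW => n; case/andP: ((vP n).1 c).
  by apply: (cvgr_to_le (uP c)); apply: nearW => n; case/andP: ((vP n).1 c).
have /choice[rs rsP] n : exists rs : (T -> R) * (T -> R), (pickle c < n)%N ->
    [/\ forall c', `|rs.1 c' - v n c'| <= n.+1%:R^-1,
        forall c', `|rs.2 c' - v n c'| <= n.+1%:R^-1,
        0 <= rs.1 c * G c rs.1 & (1 - rs.2 c) * G c rs.2 <= 0].
  (* The pair [(u, u)] only fills the finitely many ranks [n] not yet covering [c]. *)
  have [cn|_] := ltnP (pickle c) n; last by exists (u, u).
  by have [r [s H]] := (vP n).2 _ cn; exists (r, s).
have cU : \forall n \near U, (pickle c < n)%N by apply: ooU; exists (pickle c).+1.
have rc : forall c, (rs n).1 c @[n --> U] --> u c.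
  by apply: close; apply: filterS cU => n /rsP[].
have sc : forall c, (rs n).2 c @[n --> U] --> u c.
  by apply: close; apply: filterS cU => n /rsP[].
split.
  have h : (rs n).1 c * G c (rs n).1 @[n --> U] --> u c * G c u.
    by apply: cvgM; [exact: rc|exact: G_continuous].
  by apply: (cvgr_to_ge h); apply: filterS cU => n /rsP[].
have h : (1 - (rs n).2 c) * G c (rs n).2 @[n --> U] --> (1 - u c) * G c u.
  by apply: cvgM; [apply: cvgB; [exact: cvg_cst|exact: sc]|exact: G_continuous].
by apply: (cvgr_to_le h); apply: filterS cU => n /rsP[].
Unshelve. all: by end_near. Qed.
End BoxComplementarity.

(** * Stick breaking *)

Section StickBreaking.
Variables (R : realType) (Mv : eqType).
Implicit Types (u : nat -> R) (s : seq Mv) (Q : Mv -> R).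

(** The last move takes all the mass that remains, which makes the weights of a nonempty
    duplicate-free list sum to 1. *)
Fixpoint stick u s m : R :=
  if s is m0 :: s' then
    if s' is [::] then (m == m0)%:R
    else u 0 * (m == m0)%:R + (1 - u 0) * stick (fun j => u j.+1) s' m
  else 0.

(** For at least two distinct moves, this is the derivative in [u 0] of the mean of [Q] under
    [stick u s]. *)
Definition gain u s Q : R :=
  if s is m0 :: s' then
    Q m0 - \sum_(m <- s') stick (fun j => u j.+1) s' m * Q m
  else 0.

Lemma stick_cons u m0 s m : s != [::] -> stick u (m0 :: s) m =
  u 0 * (m == m0)%:R + (1 - u 0) * stick (fun j => u j.+1) s m.
Proof. by case: s. Qed.

Lemma stick_ge0 u s m : (forall j, 0 <= u j <= 1) -> 0 <= stick u s m.
Proof.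
elim: s u => [|m0 s IH] u u01; first exact: lexx.
have [->|s0] := eqVneq s [::]; first exact: ler0n.
rewrite stick_cons //; case/andP: (u01 0%N) => u0 u1.
rewrite addr_ge0 // mulr_ge0 ?ler0n ?subr_ge0 //.
by apply: IH => j; exact: u01.
Qed.

Lemma stick_notin u s m : m \notin s -> stick u s m = 0.
Proof.
elim: s u => [|m0 s IH] u //.
rewrite in_cons negb_or => /andP[/negPf m0E ms].
have [->|s0] := eqVneq s [::]; first by rewrite /= m0E.
by rewrite stick_cons // m0E mulr0 add0r (IH _ ms) mulr0.
Qed.

Lemma sum_stick_cons u m0 s Q : s != [::] -> uniq (m0 :: s) ->
  \sum_(m <- m0 :: s) stick u (m0 :: s) m * Q m =
  u 0 * Q m0 + (1 - u 0) * \sum_(m <- s) stick (fun j => u j.+1) s m * Q m.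
Proof.
move=> s0 /andP[m0s _]; rewrite big_cons stick_cons // eqxx mulr1.
rewrite (stick_notin _ m0s) mulr0 addr0; congr (_ + _).
rewrite mulr_sumr big_seq [RHS]big_seq; apply: eq_bigr => m ms.
rewrite stick_cons // mulrA.
have /negPf-> : m != m0 by apply: contraNneq m0s => <-.
by rewrite mulr0 add0r.
Qed.

Lemma sum_stick u s : s != [::] -> uniq s -> \sum_(m <- s) stick u s m = 1.
Proof.
move=> s0 us; under eq_bigr do rewrite -[stick _ _ _]mulr1.
elim: s u s0 us => // m0 [|m1 s] IH u _ us.
  by rewrite big_seq1 /= eqxx mulr1.
rewrite sum_stick_cons // IH //; last by case/andP: us.
by rewrite !mulr1 addrC subrK.
Qed.

(** Backward induction along the list: with [V] the mean over the tail, the two sign conditions say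
    that [u 0 * Q m0 + (1 - u 0) * V] is at least [V] and at least [Q m0]. *)
Lemma stick_optimal u s Q : uniq s -> (forall j, 0 <= u j <= 1) ->
  (forall j, 0 <= u j * gain (fun l => u (j + l)%N) (drop j s) Q /\
     (1 - u j) * gain (fun l => u (j + l)%N) (drop j s) Q <= 0) ->
  forall m, m \in s -> Q m <= \sum_(m' <- s) stick u s m' * Q m'.
Proof.
elim: s u => // m0 s IH u us u01 opt m.
have [->|s0] := eqVneq s [::].
  by rewrite inE big_seq1 /= eqxx mul1r => /eqP->.
rewrite sum_stick_cons // in_cons.
set V := \sum_(m <- s) _.
have g0 : 0 <= u 0%N * (Q m0 - V) := (opt 0%N).1.
have g1 : (1 - u 0%N) * (Q m0 - V) <= 0 := (opt 0%N).2.
case/predU1P => [->|ms].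
  by rewrite -subr_le0; apply: le_trans g1; rewrite le_eqVlt; apply/orP; left; apply/eqP; ring.
have QV : Q m <= V.
  by apply: (IH (fun j => u j.+1)) => //; case/andP: us.
apply: le_trans QV _; rewrite -subr_ge0; apply: le_trans g0 _.
by rewrite le_eqVlt; apply/orP; left; apply/eqP; ring.
Qed.

Lemma cvg_stick (U : set_system nat) (v : nat -> nat -> R) u s m : Filter U ->
  (forall j, v n j @[n --> U] --> u j) ->
  stick (v n) s m @[n --> U] --> stick u s m.
Proof.
move=> FU; elim: s v u => [|m0 [|m1 s] IH] v u vu; try exact: cvg_cst.
apply: cvgD; apply: cvgM; [exact: vu|exact: cvg_cst| |].
  by apply: cvgB; [exact: cvg_cst|exact: vu].
exact: (IH (fun n j => v n j.+1) (fun j => u j.+1) (fun j => vu j.+1)).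
Qed.

Lemma cvg_gain (U : set_system nat) (v : nat -> nat -> R) u s
    (Qn : nat -> Mv -> R) Q : Filter U ->
  (forall j, v n j @[n --> U] --> u j) ->
  (forall m, Qn n m @[n --> U] --> Q m) ->
  gain (v n) s (Qn n) @[n --> U] --> gain u s Q.
Proof.
move=> FU vu QnQ; case: s => [|m0 s]; first exact: cvg_cst.
apply: cvgB; first exact: QnQ.
apply: cvg_big => [|m _]; first exact: add_continuous.
apply: cvgM; last exact: QnQ.
exact: (@cvg_stick _ (fun n j => v n j.+1) (fun j => u j.+1)).
Qed.
End StickBreaking.

(** * Perfect recall and counterfactual values *)

Section PrefixRcons.
Variable T : eqType.
Implicit Types h z : seq T.

Lemma prefix_rcons2 h z m : prefix h (rcons z m) = (h == rcons z m) || prefix h z.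
Proof.
apply/idP/orP => [/prefixP[t]|[/eqP->|/prefixP[t ->]]].
- case/lastP: t => [|t m']; first by rewrite cats0 => ->; left.
  by rewrite -rcons_cat => /rcons_inj[-> _]; right; exact: prefix_prefix.
- exact: prefix_refl.
- by rewrite rcons_cat prefix_prefix.
Qed.

Lemma prefix_proper h z : prefix h z -> h != z -> exists m, prefix (rcons h m) z.
Proof.
case/prefixP => -[|m t] ->; first by rewrite cats0 eqxx.
by move=> _; exists m; rewrite -cat_rcons prefix_prefix.
Qed.

Lemma prefix_of_rcons h z m : prefix (rcons h m) z -> prefix h z.
Proof. exact/prefix_trans/prefix_rcons. Qed.

Lemma size_prefix_rcons h z m : prefix (rcons h m) z -> (size h < size z)%N.
Proof. by move/size_prefix; rewrite size_rcons. Qed.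
End PrefixRcons.

(** * Products of move probabilities along a path *)

Section PathWeight.
Variables (R : realType) (Mv : eqType).
Implicit Types (st : seq Mv -> Mv -> R) (P : pred (seq Mv)) (r h : seq Mv).

(* Histories are given in reverse, as in [probr]. *)
Fixpoint wt st P r : R :=
  if r is m :: r' then wt st P r' * (if P (rev r') then st (rev r') m else 1)
  else 1.

Lemma wt_split st P r : wt st xpredT r = wt st P r * wt st (predC P) r.
Proof.
elim: r => [|m r IH] /=; first by rewrite mulr1.
by rewrite IH; case: (P (rev r)); rewrite /= mulr1 ?mulrA // mulrAC.
Qed.

Lemma eq_wt st1 st2 P r :
  (forall h m, prefix (rcons h m) (rev r) -> P h -> st1 h m = st2 h m) ->
  wt st1 P r = wt st2 P r.
Proof.
elim: r => //= m r IH st12; rewrite IH; last first.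
  by move=> h m' hm; apply: st12; rewrite rev_cons prefix_rcons2 hm orbT.
case: ifP => // Pr; rewrite st12 //; last by rewrite rev_cons prefix_refl.
Qed.

Lemma wt_ge0 st P r :
  (forall h m, prefix (rcons h m) (rev r) -> P h -> 0 <= st h m) -> 0 <= wt st P r.
Proof.
elim: r => //= m r IH st0; rewrite mulr_ge0 ?IH //.
  by move=> h m' hm; apply: st0; rewrite rev_cons prefix_rcons2 hm orbT.
by case: ifP => // Pr; apply: st0 => //; rewrite rev_cons prefix_refl.
Qed.

Lemma wt_short st n r : (size r <= n)%N -> wt st (fun h => n <= size h)%N r = 1.
Proof.
elim: r => //= m r IH rn; rewrite IH ?(ltnW rn) // mul1r size_rev.
by rewrite leqNgt rn.
Qed.

(** Telescoping of a difference of products: the term of a prefix [rcons h m] uses [st1] before [h],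
    the difference at [h], and [st2] after it. Along [r], the size condition singles out the later
    histories. *)
Lemma wt_diff st1 st2 (H : seq (seq Mv)) (M : seq Mv) r :
  uniq H -> uniq M ->
  (forall h m, prefix (rcons h m) (rev r) -> h \in H /\ m \in M) ->
  wt st1 xpredT r - wt st2 xpredT r =
  \sum_(h <- H) \sum_(m <- M) (prefix (rcons h m) (rev r))%:R *
     (wt st1 xpredT (rev h) * (st1 h m - st2 h m) *
      wt st2 (fun h' => size h < size h')%N r).
Proof.
move=> uH uM; elim: r => [|m0 r IH] rHM.
  rewrite subrr big1 // => h _; rewrite big1 // => m _.
  by rewrite prefixs0 -size_eq0 size_rcons mul0r.
rewrite /=.
set w1 := wt st1 xpredT r; set w2 := wt st2 xpredT r.
have -> : w1 * st1 (rev r) m0 - w2 * st2 (rev r) m0 =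
  (w1 - w2) * st2 (rev r) m0 + w1 * (st1 (rev r) m0 - st2 (rev r) m0) by ring.
have rH : rev r \in H /\ m0 \in M by apply: rHM; rewrite rev_cons prefix_refl.
rewrite IH; last first.
  by move=> h m hm; apply: rHM; rewrite rev_cons prefix_rcons2 hm orbT.
have -> : w1 * (st1 (rev r) m0 - st2 (rev r) m0) =
  \sum_(h <- H) \sum_(m <- M) ((h == rev r) && (m == m0))%:R *
     (w1 * (st1 (rev r) m0 - st2 (rev r) m0)).
  rewrite (bigD1_seq _ rH.1) //= eqxx [X in _ = _ + X]big1 ?addr0; last first.
    by move=> h /negPf->; rewrite big1 // => m _; rewrite mul0r.
  rewrite (bigD1_seq _ rH.2) //= eqxx mul1r [X in _ = _ + X]big1 ?addr0 // => m /negPf->.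
  by rewrite mul0r.
rewrite mulr_suml -big_split; apply: eq_bigr => h _ /=.
rewrite mulr_suml -big_split; apply: eq_bigr => m _ /=.
rewrite rev_cons prefix_rcons2 eqseq_rcons size_rev.
have [hr|] := boolP (prefix (rcons h m) (rev r)).
  have := size_prefix_rcons hr; rewrite size_rev => hr'.
  have /negPf-> : h != rev r.
    by apply: contraTneq hr' => ->; rewrite size_rev ltnn.
  by rewrite hr' /= mul0r addr0 !mul1r mulrA.
rewrite orbF mul0r mul0r add0r => _.
have [->|] := eqVneq h (rev r); last by rewrite !mul0r.
have [->|] := eqVneq m m0; last by rewrite !mul0r.
by rewrite revK size_rev ltnn mulr1 wt_short ?mulr1.
Qed.

Lemma cvg_wt (U : set_system nat) (stn : nat -> seq Mv -> Mv -> R) st P r :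
  Filter U -> (forall h m, stn n h m @[n --> U] --> st h m) ->
  wt (stn n) P r @[n --> U] --> wt st P r.
Proof.
move=> FU cst; elim: r => [|m r IH] /=; first exact: cvg_cst.
by apply: cvgM => //; case: ifP => _; [exact: cst|exact: cvg_cst].
Qed.
End PathWeight.

(** * From local to global optimality within one game *)

Section OneGame.
Variables (R : realType) (Mv : eqType) (a : xgame Mv R) (i : nat).
Variables (C : pred (seq Mv)) (rep : seq Mv -> seq Mv).
Implicit Types (h k : seq Mv) (st : seq Mv -> Mv -> R).
Hypothesis a_wf : wf_game a.
Hypothesis C_player : forall h, C h -> xP a h = Some i.
Hypothesis C_same : forall h h', xsame a h h' -> C h -> C h'.
Hypothesis rep_same : forall h, plays a h (Some i) -> C h -> xsame a h (rep h).
Hypothesis rep_const : forall h h', xsame a h h' -> C h -> rep h = rep h'.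

Let sameP h h' : xsame a h h' ->
  exists j, plays a h (Some j) /\ plays a h' (Some j).
Proof. by case: a_wf => _ [_ [_ [_ [_ [[H _ _ _ _] _]]]]]; exact: H. Qed.
Let sameC h h' : xsame a h h' -> xsame a h' h.
Proof. by case: a_wf => _ [_ [_ [_ [_ [[_ _ H _ _] _]]]]]; exact: H. Qed.
Let same_trans h1 h2 h3 : xsame a h1 h2 -> xsame a h2 h3 -> xsame a h1 h3.
Proof. by case: a_wf => _ [_ [_ [_ [_ [[_ _ _ H _] _]]]]]; exact: H. Qed.
Let recall : perfect_recall a.
Proof. by case: a_wf => _ [_ [_ [_ [_ [_ H]]]]]. Qed.
Let closedH h h' : h' \in xH a -> prefix h h' -> h \in xH a.
Proof. by case: a_wf => _ [H _]; exact: H. Qed.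

Lemma plays_C h : h \in xH a -> ~~ term a h -> C h -> plays a h (Some i).
Proof. by move=> hH hT Ch; rewrite /plays hH hT C_player /=. Qed.

Lemma strict_prefix_plays h m z :
  z \in xH a -> prefix (rcons h m) z -> h \in xH a /\ ~~ term a h.
Proof.
move=> zH hz; have hH := closedH zH (prefix_of_rcons hz); split => //.
rewrite /term hH negbK; apply/hasP; exists z => //.
rewrite /strict_prefix (prefix_of_rcons hz); apply: contraTneq hz => <-.
by apply/negP => /size_prefix_rcons; rewrite ltnn.
Qed.

(** If [rcons h1 m] were a prefix of [h], recall would give a prefix [h1'] of [h1] in the same cell
    with [rcons h1' m] still a prefix of [h1]. Induction forces [h1' = h1], which is absurd. *)
Lemma no_absentmindedness h h1 : xsame a h h1 -> prefix h1 h -> h1 = h.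
Proof.
have [n] := ubnP (size h); elim: n h h1 => // n IH h h1 hn hh1 h1h.
apply/eqP; apply: contraT => /(prefix_proper h1h)[m h1mh].
have [j [hj h1j]] := sameP hh1.
have [h1' [h1'h1 h1s /(_ m h1mh) h1'm]] := recall hh1 hj h1h h1j.
have E : h1' = h1 by apply: IH => //; apply: leq_trans (size_prefix_rcons h1mh) _.
by move: h1'm; rewrite E => /size_prefix_rcons; rewrite ltnn.
Qed.

(** The player's record of own choices, each information set being named by its representative; it
    determines the own reach probability. *)
Fixpoint own_moves (r : seq Mv) : seq (seq Mv * Mv) :=
  if r is m :: r' then
    if C (rev r') then (rep (rev r'), m) :: own_moves r' else own_moves r'
  else [::].

Lemma mem_own_moves h k m : (k, m) \in own_moves (rev h) <->
  exists h1, [/\ C h1, prefix (rcons h1 m) h & rep h1 = k].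
Proof.
elim/last_ind: h => [|h m0 IH].
  by split=> // -[h1 [_]]; rewrite prefixs0 -size_eq0 size_rcons.
rewrite rev_rcons /= revK; split.
  have IHl : (k, m) \in own_moves (rev h) ->
    exists h1, [/\ C h1, prefix (rcons h1 m) (rcons h m0) & rep h1 = k].
    by case/IH => h1 [Ch1 h1h rk]; exists h1; split; rewrite // prefix_rcons2 h1h orbT.
  case: ifP => // Ch; rewrite in_cons => /orP[/eqP[-> ->]|//].
  by exists h; rewrite prefix_refl.
case=> h1 [Ch1]; rewrite prefix_rcons2 => /orP[/eqP/rcons_inj[E1 E2]|h1h] rk.
  by rewrite -E1 -E2 Ch1 rk mem_head.
have : (k, m) \in own_moves (rev h) by apply/IH; exists h1.
by case: ifP => //; rewrite in_cons orbC => _ ->.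
Qed.

Lemma uniq_own_moves h : h \in xH a -> uniq (own_moves (rev h)).
Proof.
elim/last_ind: h => // h m IH hmH.
have [hH hT] := strict_prefix_plays hmH (prefix_refl _).
rewrite rev_rcons /= revK; case: ifP => [Ch|_]; last exact: IH.
rewrite /= IH // andbT; apply/negP => /mem_own_moves[h1 [Ch1 h1h rE]].
have [h1H h1T] := strict_prefix_plays hH h1h.
have h1s := rep_same (plays_C h1H h1T Ch1).
have hs := rep_same (plays_C hH hT Ch).
have E : h1 = h.
  apply: no_absentmindedness (prefix_of_rcons h1h).
  by apply: same_trans (hs Ch) _; rewrite -rE; exact/sameC/h1s.
by move/size_prefix_rcons: h1h; rewrite E ltnn.
Qed.

Lemma sub_own_moves h h' : xsame a h h' -> C h ->
  {subset own_moves (rev h) <= own_moves (rev h')}.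
Proof.
move=> hh' Ch [k m] /mem_own_moves[h1 [Ch1 h1h rk]].
have [j [hj _]] := sameP hh'.
have hH : h \in xH a by case/and3P: hj.
have ji : Some j = Some i by case/and3P: hj => _ _ /eqP <-; exact: C_player.
have [h1H h1T] := strict_prefix_plays hH h1h.
have h1i := plays_C h1H h1T Ch1; rewrite -ji in h1i.
have [h1' [h1'h' h1s h1m]] := recall hh' hj (prefix_of_rcons h1h) h1i.
apply/mem_own_moves; exists h1'; split; [exact: C_same h1s _|exact: h1m|].
by rewrite -(rep_const h1s).
Qed.

Lemma wt_own st h : h \in xH a ->
  (forall h', plays a h' (Some i) -> C h' -> st (rep h') =1 st h') ->
  wt st C (rev h) = \prod_(km <- own_moves (rev h)) st km.1 km.2.
Proof.
move=> hH st_rep; elim/last_ind: h hH => [|h m IH] hmH; first by rewrite big_nil.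
have [hH hT] := strict_prefix_plays hmH (prefix_refl _).
rewrite rev_rcons /= revK IH //; case: ifP => [Ch|_]; last by rewrite mulr1.
by rewrite big_cons mulrC /= st_rep //; exact: plays_C.
Qed.

Lemma wt_own_same st h h' :
  (forall h', plays a h' (Some i) -> C h' -> st (rep h') =1 st h') ->
  xsame a h h' -> C h -> wt st C (rev h) = wt st C (rev h').
Proof.
move=> st_rep hh' Ch; have [j [/and3P[hH _ _] /and3P[h'H _ _]]] := sameP hh'.
(* Perfect recall equates the two records only as sets; absence of repetitions upgrades this to a
   permutation. *)
rewrite !wt_own //; apply: perm_big; apply: uniq_perm; try exact: uniq_own_moves.
move=> km; apply/idP/idP; first exact: sub_own_moves.
by apply: sub_own_moves; [exact: sameC|exact: C_same Ch].
Qed.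

Let H := undup [seq h <- xH a | ~~ term a h].
Let M := undup (xM a).
Let Z := undup [seq z <- xH a | term a z].

(** The strict inequality leaves out the probability of [m] at [h], as if [m] had been chosen. *)
Definition cont_value st h m : R :=
  \sum_(z <- Z) (prefix (rcons h m) z)%:R *
    (wt st (fun h' => size h < size h')%N (rev z) * xu a i z).

(* Counterfactual value of the move [m] at the information set of [k]: the
   player's own probability of reaching the information set is left out. *)
Definition cf_value st k m : R :=
  \sum_(h <- H | xsame a k h) wt st (predC C) (rev h) * cont_value st h m.

(* Performance difference: replacing [st2] by [st1] changes the expected
   utility by the sum over the information sets of the own reach probability
   under [st1] times the one-step counterfactual gain evaluated at [st2]. *)
Lemma locally_optimal_optimal st1 st2 :
  (forall h m, ~~ C h -> st1 h m = st2 h m) ->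
  (forall h m, plays a h (Some i) -> C h -> 0 <= st1 h m) ->
  (forall h, plays a h (Some i) -> C h -> st1 (rep h) =1 st1 h) ->
  (forall h, plays a h (Some i) -> C h -> st2 (rep h) =1 st2 h) ->
  (forall k, plays a k (Some i) -> C k ->
     \sum_(m <- M) st1 k m * cf_value st2 k m <=
     \sum_(m <- M) st2 k m * cf_value st2 k m) ->
  \sum_(z <- Z) wt st1 xpredT (rev z) * xu a i z <=
  \sum_(z <- Z) wt st2 xpredT (rev z) * xu a i z.
Proof.
move=> st12 st1_ge0 rep1 rep2 opt; rewrite -subr_le0 -sumrB.
have HP h : h \in H -> h \in xH a /\ ~~ term a h.
  by rewrite mem_undup mem_filter => /andP[].
have uH : uniq H by exact: undup_uniq.
have -> : \sum_(z <- Z) (wt st1 xpredT (rev z) * xu a i z -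
                         wt st2 xpredT (rev z) * xu a i z) =
  \sum_(h <- H | C h) wt st1 C (rev h) * (wt st2 (predC C) (rev h) *
     \sum_(m <- M) (st1 h m - st2 h m) * cont_value st2 h m).
  rewrite big_seq (eq_bigr (fun z => \sum_(h <- H) \sum_(m <- M)
     (wt st1 xpredT (rev h) * (st1 h m - st2 h m)) *
     ((prefix (rcons h m) z)%:R *
      (wt st2 (fun h' => size h < size h')%N (rev z) * xu a i z)))); last first.
    move=> z; rewrite mem_undup mem_filter => /andP[_ zH].
    rewrite -mulrBl (@wt_diff _ _ _ _ H M) ?undup_uniq //; last first.
      rewrite revK => h m hz; have [hH hT] := strict_prefix_plays zH hz.
      rewrite mem_undup mem_filter hT hH mem_undup; split => //.
      have hmH := closedH zH hz.
      case: a_wf => _ [_ [sub _]]; apply: (sub _ hmH).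
      by rewrite mem_rcons mem_head.
    rewrite revK mulr_suml; apply: eq_bigr => h _; rewrite mulr_suml.
    by apply: eq_bigr => m _; rewrite mulrCA -!mulrA.
  rewrite -big_seq exchange_big /= (bigID C) /= addrC big1 ?add0r; last first.
    move=> h nC; rewrite big1 // => z _; rewrite big1 // => m _.
    by rewrite st12 // subrr mulr0 mul0r.
  apply: eq_bigr => h _; rewrite exchange_big /= !mulr_sumr.
  apply: eq_bigr => m _.
  rewrite -mulr_sumr (wt_split st1 C) -!mulrA; congr (_ * (_ * _)).
  by apply: eq_wt => h' m' _ /= nC; exact: st12.
(* Grouping by information set: the own reach probability and both strategies are constant on a
   cell, so they are evaluated at its representative [k]. *)
have -> : \sum_(h <- H | C h) wt st1 C (rev h) * (wt st2 (predC C) (rev h) *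
     \sum_(m <- M) (st1 h m - st2 h m) * cont_value st2 h m) =
  \sum_(k <- H) \sum_(h <- H | C h && (k == rep h)) wt st1 C (rev k) *
    (wt st2 (predC C) (rev h) * \sum_(m <- M) (st1 k m - st2 k m) * cont_value st2 h m).
  under [RHS]eq_bigr do rewrite big_mkcondr.
  rewrite exchange_big /= big_seq_cond [RHS]big_seq_cond; apply: eq_bigr => h /andP[hH Ch].
  have [hH' hT] := HP _ hH; have hi := plays_C hH' hT Ch.
  have hs := rep_same hi Ch; have [j [_ /and3P[kH kT _]]] := sameP hs.
  have kin : rep h \in H by rewrite mem_undup mem_filter kT.
  rewrite (bigD1_seq _ kin uH) /= eqxx [X in _ = _ + X]big1 ?addr0; last first.
    by move=> k /negPf->.
  rewrite (wt_own_same rep1 hs Ch); do 2!congr (_ * _).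
  by apply: eq_bigr => m _; rewrite rep1 // rep2.
rewrite big_seq; apply: sumr_le0 => k kH; have [kH' kT] := HP _ kH.
(* A [k] that does not represent its own cell receives no term. *)
have [/andP[Ck /eqP rk]|nk] := boolP (C k && (rep k == k)); last first.
  rewrite big_seq_cond big_pred0 // => h; apply: contraNF nk => /and3P[hH Ch /eqP->].
  have [hH' hT] := HP _ hH; have hs := rep_same (plays_C hH' hT Ch) Ch.
  by rewrite (C_same hs Ch) -(rep_const hs Ch) eqxx.
have ki := plays_C kH' kT Ck.
rewrite big_seq_cond (eq_bigl (fun h => (h \in H) && xsame a k h)); last first.
  move=> h; case hH: (h \in H) => //=; have [hH' hT] := HP _ hH.
  apply/andP/idP => [[Ch /eqP->]|kh]; first exact: sameC (rep_same (plays_C hH' hT Ch) Ch).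
  by rewrite -(rep_const kh Ck) rk eqxx (C_same kh Ck).
rewrite -big_seq_cond -mulr_sumr mulr_ge0_le0 //.
  apply: wt_ge0 => h m; rewrite revK => hk Ch.
  have [hH hT] := strict_prefix_plays kH' hk.
  exact: st1_ge0 (plays_C hH hT Ch) Ch.
have optk := opt _ ki Ck; rewrite -subr_le0 -sumrB in optk; apply: le_trans optk.
rewrite le_eqVlt; apply/orP; left; apply/eqP.
under eq_bigr do rewrite mulr_sumr.
rewrite exchange_big /=; apply: eq_bigr => m _.
rewrite -mulrBl mulr_sumr; apply: eq_bigr => h _.
by rewrite mulrCA.
Qed.

Lemma cvg_cf_value (U : set_system nat) (stn : nat -> seq Mv -> Mv -> R) st k m :
  Filter U -> (forall h m, stn n h m @[n --> U] --> st h m) ->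
  cf_value (stn n) k m @[n --> U] --> cf_value st k m.
Proof.
move=> FU cst; apply: cvg_big => [|h _]; first exact: add_continuous.
apply: cvgM; first exact: cvg_wt.
apply: cvg_big => [|z _]; first exact: add_continuous.
apply: cvgM; first exact: cvg_cst.
by apply: cvgM; [exact: cvg_wt|exact: cvg_cst].
Qed.
End OneGame.

(** * Games with awareness of unawareness *)

Lemma sum_supported (R : realType) (T : eqType) (s M : seq T) (p Q : T -> R) :
  uniq s -> uniq M -> {subset s <= M} -> (forall m, m \notin s -> p m = 0) ->
  \sum_(m <- M) p m * Q m = \sum_(m <- s) p m * Q m.
Proof.
move=> us uM sM p0; rewrite (bigID (mem s)) /= [X in _ + X]big1 ?addr0; last first.
  by move=> m ms; rewrite p0 ?mul0r.
rewrite -big_filter; apply/perm_big/uniq_perm; rewrite ?filter_uniq // => m.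
by rewrite mem_filter; apply/andP/idP => [[]|ms] //; rewrite ms sM.
Qed.

Lemma le_dist_sum (R : realType) (Mv : eqType) (s : seq Mv) (p Q : Mv -> R) V :
  is_dist s p -> (forall m, m \in s -> Q m <= V) -> \sum_(m <- s) p m * Q m <= V.
Proof.
case=> p0 _ p1 QV; rewrite -[V]mul1r -p1 mulr_suml big_seq [leRHS]big_seq.
by apply: ler_sum => m ms; rewrite ler_wpM2l ?QV.
Qed.

Section InformationSets.
Variables (R : realType) (Mv : eqType) (a : xgame Mv R) (i : nat).
Hypothesis a_wf : wf_game a.

Lemma mem_movesAt h m : (m \in movesAt a h) = (rcons h m \in xH a).
Proof.
rewrite mem_undup mem_filter; apply/andP/idP => [[]|] // hm; split => //.
by case: a_wf => _ [_ [sub _]]; apply: (sub _ hm); rewrite mem_rcons mem_head.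
Qed.

Lemma movesAt_nonempty h o : plays a h o -> movesAt a h != [::].
Proof.
case/and3P => hH; rewrite /term hH negbK => /hasP[h' h'H /andP[hh' ne]] _.
have [m hm] := prefix_proper hh' ne.
have : m \in movesAt a h.
  by rewrite mem_movesAt; case: a_wf => _ [cl _]; apply: cl hm.
by case: (movesAt a h).
Qed.

Lemma infoset_plays I h : is_infoset a i I -> h \in I -> plays a h (Some i).
Proof.
case: a_wf => _ [_ [_ [_ [_ [[same _ _ _ _] _]]]]] [h0 [h0i ->]] /same[j [h0j hj]].
suff <- : Some j = Some i by [].
by case/and3P: h0i => _ _ /eqP<-; case/and3P: h0j => _ _ /eqP<-.
Qed.

Lemma movesI_movesAt I k : is_infoset a i I -> k \in I -> movesI a I =i movesAt a k.
Proof.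
case: a_wf => _ [_ [_ [_ [_ [[_ _ sC sT mE] _]]]]] [h0 [h0i IE]] kI m.
rewrite mem_undup; apply/flatten_mapP/idP => [[h hI]|mk]; last by exists k.
rewrite !mem_movesAt (mE h k) //; apply: sT (_ : xsame a h0 k); last by rewrite -IE.
by apply: sC; rewrite -IE.
Qed.

(** Depends on [I] only through membership, so two lists of the same cell share their coordinates; a
    natural number keeps the set of coordinates countable although [Mv] is arbitrary. *)
Definition infoset_index (I : seq (seq Mv)) : nat := find (fun h => h \in I) (xH a).
Definition infoset_rep I : seq Mv := nth [::] (xH a) (infoset_index I).

Lemma infoset_rep_in I : is_infoset a i I -> infoset_rep I \in I.
Proof.
case: (a_wf) => _ [_ [_ [_ [_ [[_ refl _ _ _] _]]]]] [h0 [h0i IE]].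
apply: (@nth_find _ [::] (fun h => h \in I)); apply/hasP; exists h0.
  by case/and3P: h0i.
by rewrite IE; exact: refl h0i.
Qed.

Lemma eq_infoset_index I I' : I =i I' -> infoset_index I = infoset_index I'.
Proof. by move=> II'; apply: eq_find => h; rewrite II'. Qed.
End InformationSets.

(** * The profile defined by a point of the cube *)

Section Profile.
Variables (R : realType) (Mv : eqType) (G : countType) (g : xgame Mv R).
Variables (gam : G -> xgame Mv R) (m0 : G) (F : G -> seq Mv -> G * seq (seq Mv)).
Hypothesis gau : game_awareness_unawareness g gam m0 F.

Implicit Types (i : nat) (x y : G) (u : G * nat * nat -> R).

(* The coordinate [(y, n, j)] is the probability, at the information set of
   [gam y] represented by its [n]-th history, of stopping at the [j]-th move
   when the previous ones have been passed. *)
Definition stick_profile u : profile Mv R G := fun i y x h =>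
  let n := infoset_index (gam y) (F x h).2 in
  stick (fun j => u (y, n, j)) (movesAt (gam y) (infoset_rep (gam y) (F x h).2)).

(** Exactly the histories of [gam y] at which play is drawn from the local strategy of [i] for
    [gam y], hence where a deviation can act. *)
Definition controls i y h := (xP (gam y) h == Some i) && ((F y h).1 == y).

(** The mover is read off at [k], so coordinates need not name a player; the default [0] is taken
    only when [xP] returns [None]. *)
Definition move_value u y k : Mv -> R :=
  let i := odflt 0%N (xP (gam y) k) in
  cf_value (gam y) i (controls i y) (step gam F (stick_profile u) y) k.

Definition stick_gain (c : G * nat * nat) u : R :=
  let: (y, n, j) := c in
  let k := nth [::] (xH (gam y)) n in
  gain (fun l => u (y, n, (j + l)%N)) (drop j (movesAt (gam y) k)) (move_value u y k).

Lemma cvg_stick_gain (U : set_system nat) : ProperFilter U ->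
  forall (v : nat -> G * nat * nat -> R) u,
  (forall c, v n c @[n --> U] --> u c) ->
  forall c, stick_gain c (v n) @[n --> U] --> stick_gain c u.
Proof.
move=> FU v u vu [[y n] j].
apply: (@cvg_gain _ _ U (fun N l => v N (y, n, (j + l)%N))
  (fun l => u (y, n, (j + l)%N))) => [l|m]; first exact: vu.
apply: cvg_cf_value => h m'; rewrite /step; case: (xP (gam y) h) => [i|].
  by apply: (@cvg_stick _ _ U (fun N l => v N (_, _, l)) (fun l => u (_, _, l))) => l; exact: vu.
exact: cvg_cst.
Qed.

Let wf x : wf_game (gam x).
Proof. by case: gau => aug _ _ _; case: (aug x). Qed.

Let condF x h i : plays (gam x) h (Some i) -> cond_F g gam F x h i.
Proof.
move=> hi; case: gau => _ _ _; apply => //.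
by case: (wf x) => _ [_ [_ [N _]]]; exact: N hi.
Qed.

Let infosetF x h i : plays (gam x) h (Some i) ->
  is_infoset (gam (F x h).1) i (F x h).2.
Proof. by case/condF. Qed.

(** Condition A6 equates the awareness sets at [h] and [h'], which is what C5 requires. *)
Lemma same_F x h h' i : plays (gam x) h (Some i) -> xsame (gam x) h h' ->
  plays (gam x) h' (Some i) /\ Feq (F x h') (F x h).
Proof.
move=> hi hh'; have h'i : plays (gam x) h' (Some i).
  case: (wf x) => _ [_ [_ [_ [_ [[same _ _ _ _] _]]]]].
  have [j [hj h'j]] := same _ _ hh'.
  suff <- : Some j = Some i by [].
  by case/and3P: hi => _ _ /eqP<-; case/and3P: hj => _ _ /eqP<-.
split=> //; case: (condF hi) => _ [_ [_ [_ [_ [C5 _]]]]].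
have AE : xA (gam x) i h' =i xA (gam x) i h.
  case: gau => aug _ _ _; case: (aug x) => _ [_ [_ [_ [_ [A6 _]]]]].
  by move=> h''; rewrite (A6 i h h').
by have [+ _] := C5 h' h'i AE; apply.
Qed.

Section Control.
Variables (i : nat) (y : G).
Local Notation a := (gam y).
Local Notation C := (controls i y).

Definition own_rep h := infoset_rep a (F y h).2.

Lemma controls_player h : C h -> xP a h = Some i.
Proof. by case/andP => /eqP. Qed.

Lemma controls_same h h' : xsame a h h' -> C h -> C h'.
Proof.
move=> hh' Ch; case: (wf y) => _ [_ [_ [_ [_ [[same _ _ _ _] _]]]]].
have [j [hj _]] := same _ _ hh'; have [h'j [E1 _]] := same_F hj hh'.
case/and3P: hj => _ _ hj; case/and3P: h'j => _ _ h'j.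
by move: Ch; rewrite /controls E1 (eqP hj) (eqP h'j).
Qed.

(** Since [F] stays in [gam y] at [h], condition C7 identifies the believed information set with the
    actual one. *)
Lemma own_rep_same h : plays a h (Some i) -> C h -> xsame a h (own_rep h).
Proof.
move=> hi /andP[_ /eqP Ey]; have := infosetF hi; rewrite Ey => Iy.
case: (condF hi) => _ [_ [_ [_ [_ [_ [_ [C7 _]]]]]]].
apply/(C7 Ey); exact (infoset_rep_in (wf y) Iy).
Qed.

Lemma own_rep_const h h' : xsame a h h' -> C h -> own_rep h = own_rep h'.
Proof.
move=> hh' Ch; case: (wf y) => _ [_ [_ [_ [_ [[same _ _ _ _] _]]]]].
have [j [hj _]] := same _ _ hh'; have [_ [_ E2]] := same_F hj hh'.
by rewrite /own_rep /infoset_rep (eq_infoset_index _ E2).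
Qed.

Lemma step_update sigma tau h m :
  step gam F (update sigma i y tau) y h m =
  if C h then tau y h m else step gam F sigma y h m.
Proof.
rewrite /step /update /controls; case: (xP a h) => [j|//].
by rewrite (inj_eq Some_inj); case: ifP.
Qed.

Lemma step_own sigma h m : C h -> step gam F sigma y h m = sigma i y y h m.
Proof. by case/andP; rewrite /step => /eqP-> /eqP->. Qed.

Lemma local_strategy_rep tau h : local_strategy gam F i y tau ->
  plays a h (Some i) -> C h -> tau y (own_rep h) =1 tau y h.
Proof.
move=> loc hi Ch m; have hs := own_rep_same hi Ch.
have [ri [E1 E2]] := same_F hi hs; case/andP: Ch => _ /eqP Ey.
by case: (loc y h hi Ey) => _ /(_ y (own_rep h) ri)-> //; split.
Qed.

Lemma EU_wt sigma : EU gam F sigma i y =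
  \sum_(z <- undup [seq z <- xH a | term a z])
     wt (step gam F sigma y) xpredT (rev z) * xu a i z.
Proof.
by apply: eq_bigr => z _; congr (_ * _); elim: (rev z) => //= m r ->.
Qed.
End Control.

Lemma stick_profile_local u i y : in_box u ->
  local_strategy gam F i y (stick_profile u i y).
Proof.
move=> u01 x h hi Ey; split; last first.
  move=> x' h' _ [_ E2] m; rewrite /stick_profile /infoset_rep.
  by rewrite (eq_infoset_index _ E2).
have := infosetF hi; rewrite Ey => Iy.
have kI := infoset_rep_in (wf y) Iy; have mE := movesI_movesAt (wf y) Iy kI.
split=> [m|m|]; first by apply: stick_ge0 => j; exact: u01.
  by rewrite mE; exact: stick_notin.
rewrite (perm_big (movesAt (gam y) (infoset_rep (gam y) (F x h).2))).
  apply: sum_stick; last exact: undup_uniq.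
  exact (movesAt_nonempty (wf y) (infoset_plays (wf y) Iy kI)).
by apply: uniq_perm; rewrite ?undup_uniq.
Qed.

Lemma stick_profile_optimal u i y tau : in_box u ->
  (forall c, 0 <= u c * stick_gain c u /\ (1 - u c) * stick_gain c u <= 0) ->
  local_strategy gam F i y tau ->
  EU gam F (update (stick_profile u) i y tau) i y <= EU gam F (stick_profile u) i y.
Proof.
move=> u01 comp loc; rewrite !EU_wt.
have loc0 : local_strategy gam F i y (stick_profile u i y) by exact: stick_profile_local.
apply: (locally_optimal_optimal (C := controls i y) (rep := own_rep y)) => //.
- exact: controls_player.
- exact: controls_same.
- exact: own_rep_same.
- exact: own_rep_const.
- by move=> h m /negPf nC; rewrite step_update nC.
- move=> h m hi Ch; rewrite step_update Ch; case/andP: Ch => _ /eqP Ey.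
  by case: (loc y h hi Ey) => -[].
- move=> h hi Ch m; have Cr := controls_same (own_rep_same hi Ch) Ch.
  by rewrite !step_update Ch Cr (local_strategy_rep loc).
- move=> h hi Ch m; have Cr := controls_same (own_rep_same hi Ch) Ch.
  by rewrite (step_own _ _ Ch) (step_own _ _ Cr) (local_strategy_rep loc0).
move=> k ki Ck; have ks := own_rep_same ki Ck.
have [ri _] := same_F ki ks; case/andP: (Ck) => _ /eqP Ey.
set Q := cf_value _ _ _ _ k.
(* The coordinates refer to the representative; counterfactual values agree there because they sum
   over the same cell. *)
have QE : move_value u y (own_rep y k) = Q.
  apply/funext => m; rewrite /move_value /Q /cf_value.
  have -> : xP (gam y) (own_rep y k) = Some i by case/and3P: ri => _ _ /eqP.
  apply: eq_bigl => h; case: (wf y) => _ [_ [_ [_ [_ [[_ _ sC sT _] _]]]]].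
  by apply/idP/idP => [|kh]; [exact: sT|apply: sT kh; exact: sC].
set s := movesAt (gam y) (own_rep y k).
have us : uniq s by exact: undup_uniq.
have sM : {subset s <= undup (xM (gam y))}.
  by move=> m; rewrite !mem_undup mem_filter => /andP[].
have sI : movesI (gam y) (F y k).2 =i s.
  have := infosetF ki; rewrite Ey => Iy.
  exact (movesI_movesAt (wf y) Iy (infoset_rep_in (wf y) Iy)).
have distE (p : Mv -> R) : is_dist (movesI (gam y) (F y k).2) p -> is_dist s p.
  case=> p0 pn p1; split=> // [m|]; first by rewrite -sI; exact: pn.
  by rewrite -p1; apply/perm_big/uniq_perm; rewrite ?undup_uniq // => m; rewrite sI.
have tau_dist := distE _ (loc y k ki Ey).1.
under eq_bigr do rewrite step_update Ck.
under [leRHS]eq_bigr do rewrite (step_own _ _ Ck).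
rewrite (sum_supported _ us) ?undup_uniq //; last by case: tau_dist.
rewrite (sum_supported _ us) ?undup_uniq //; last by case: (distE _ (loc0 y k ki Ey).1).
(* No distribution beats the best move, and complementarity makes the mean under the profile at
   least the value of every move. *)
apply: le_dist_sum => // m ms.
apply: (stick_optimal us) => // j; rewrite -QE.
exact: (comp (y, _, j)).
Qed.
End Profile.

Theorem theorem4p1 (R : realType) (Mv : eqType) (G : countType)
  (g : xgame Mv R) (gam : G -> xgame Mv R) (m0 : G)
  (F : G -> seq Mv -> G * seq (seq Mv)) :
  wf_game g ->
  game_awareness_unawareness g gam m0 F ->
  exists sigma : profile Mv R G, generalized_nash g gam F sigma.
Proof.
move=> _ gau.
have [u [u01 comp]] := box_complementarity (@cvg_stick_gain R Mv G gam F).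
exists (stick_profile gam F u); split=> [i y _ _|i y tau _ _ loc].
  exact (stick_profile_local gau u01).
exact (stick_profile_optimal gau u01 comp loc).
Qed.
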